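(* Let $R$ be a ring, $S\subseteq R$ an $m$-system, $M$ a right $R$-module, and $P$ a submodule of $M$ with $(P:_R M)\cap S=\emptyset$. Then $P$ is an $S$-prime submodule of $M$ if and only if there exists $s\in S$ such that $(P:_M\langle s\rangle)$ is a prime submodule of $M$.
   Context: Rings are associative with unity and modules are right (unital) modules. For $s\in R$, $\langle s\rangle$ denotes the two-sided ideal generated by $s$. A nonempty subset $S\subseteq R$ is an $m$-system if for all $a,b\in S$ there is $r\in R$ with $arb\in S$. $(P:_R M)=\{r\in R: Mr\subseteq P\}$, and for a two-sided ideal $J$ of $R$, $(P:_M J)=\{m\in M: mJ\subseteq P\}$. A submodule $Q$ of $M$ is prime if for all $a\in R$, $m\in M$, $mRa\subseteq Q$ implies $a\in (Q:_R M)$ or $m\in Q$. A submodule $P$ of $M$ with $(P:_R M)\cap S=\emptyset$ is $S$-prime if there is $s\in S$ such that for all $a\in R$ and $m\in M$, $mRa\subseteq P$ implies $a\langle s\rangle\subseteq (P:_R M)$ or $m\langle s\rangle\subseteq P$. *)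

(* Defs.v *)
From mathcomp Require Import all_boot all_algebra.
From mathcomp Require Import boolp classical_sets.

Set Implicit Arguments.
Unset Strict Implicit.
Unset Printing Implicit Defensive.

Import GRing.Theory.
Local Open Scope classical_set_scope.
Local Open Scope ring_scope.

(* A right R-module is a left module over the converse ring R^c, whose product
   is (a * b : R^c) = b * a; hence (m \ra a) \ra b = m \ra (a * b) with the
   product of R on the right-hand side. *)
Definition ract (R : pzRingType) (M : lmodType R^c) (m : M) (a : R) : M :=
  (a : R^c) *: m.

Notation "m \ra a" := (ract m a) (at level 40, left associativity).

Definition submodule (R : pzRingType) (M : lmodType R^c) (P : set M) : Prop :=
  submod_closed (mem P).

(* The library's idealr structures are one-sided and proper, and live over
   nontrivial rings; the ideals needed here are two-sided and possibly equal
   to R. *)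
Definition two_sided_ideal (R : pzRingType) (J : set R) : Prop :=
  [/\ zmod_closed (mem J),
      forall r x, J x -> J (r * x)
    & forall r x, J x -> J (x * r)].

Definition gen_ideal (R : pzRingType) (s : R) : set R :=
  smallest (@two_sided_ideal R) [set s].

Definition m_system (R : pzRingType) (S : set R) : Prop :=
  S !=set0 /\ forall a b, S a -> S b -> exists r, S (a * r * b).

(* (P :_R M) *)
Definition res_ring (R : pzRingType) (M : lmodType R^c) (P : set M) : set R :=
  [set r | forall m : M, P (m \ra r)].

(* (P :_M J) *)
Definition res_mod (R : pzRingType) (M : lmodType R^c) (P : set M) (J : set R) :
    set M :=
  [set m | forall j, J j -> P (m \ra j)].

(* The hypothesis mRa `<=` Q is spelled out elementwise, (m r) a being in Q for
   every r. *)
Definition prime_submodule (R : pzRingType) (M : lmodType R^c) (Q : set M) :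
    Prop :=
  submodule Q /\
  forall (a : R) (m : M), (forall r : R, Q (m \ra r \ra a)) ->
    res_ring Q a \/ Q m.

Definition S_prime_submodule (R : pzRingType) (M : lmodType R^c) (S : set R)
    (P : set M) : Prop :=
  [/\ submodule P, res_ring P `&` S = set0
    & exists2 s, S s &
      forall (a : R) (m : M), (forall r : R, P (m \ra r \ra a)) ->
        (forall t, gen_ideal s t -> res_ring P (a * t)) \/
        (forall t, gen_ideal s t -> P (m \ra t))].

(* Main.v *)
Require Import Defs.
From mathcomp Require Import all_boot all_algebra.
From mathcomp Require Import boolp classical_sets.

Import GRing.Theory.
Local Open Scope classical_set_scope.
Local Open Scope ring_scope.

(** Write Q for (P :_M <s>). The same s serves in both directions.

    If Q is prime and m R a lies in P, then m R a lies in Q because P is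
    contained in Q; the two alternatives given by the primeness of Q are those
    of S-primeness, once M a <s> `<=` P is read as a <s> `<=` (P :_R M).

    Conversely let P be S-prime with witness s, and let m R a lie in Q with m
    outside Q. For every t in <s> one has m R (a t) `<=` P, and m <s> is not
    contained in P, so S-primeness yields M a <s> <s> `<=` P. One factor <s>
    has to be cancelled, which is where the m-system enters: choose r with
    b = s r s in S. For each n in M, (n a) R b is inside M a <s> <s>, hence
    inside P, so S-primeness applied to n a and b gives either n a <s> `<=` P,
    which is the goal, or b <s> `<=` (P :_R M). The latter is absurd: some
    b r' s lies in S, and it also lies in b <s>, whereas (P :_R M) avoids S
    ([no_ideal_multiple_in_res_ring]). *)

Section RightAction.
Variables (R : pzRingType) (M : lmodType R^c).
Implicit Types (P : set M) (J : set R).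

Lemma ractM (m : M) (a b : R) : m \ra a \ra b = m \ra (a * b).
Proof. by rewrite /ract scalerA. Qed.

Lemma submodule_ract P (m : M) (a : R) : submodule P -> P m -> P (m \ra a).
Proof.
move=> [P0 Plin] Pm; rewrite -[m \ra a]addr0.
by apply/set_mem/Plin => //; apply/mem_set.
Qed.

(** Closure under scalars uses the left absorption of J: m r j = m (r j). *)
Lemma submodule_res_mod P J :
  submodule P -> two_sided_ideal J -> submodule (res_mod P J).
Proof.
move=> [P0 Plin] [_ JMl _]; split=> [|a u v /set_mem Qu /set_mem Qv];
  apply/mem_set => j Jj.
  by rewrite /ract scaler0; apply: set_mem P0.
(* The cast selects the product of R, a being a scalar of the converse ring. *)
have -> : (a *: u + v) \ra j = (1 : R^c) *: (u \ra ((a : R) * j)) + v \ra j.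
  by rewrite scale1r -ractM /ract scalerDr.
by apply/set_mem/Plin; apply/mem_set; [exact/Qu/JMl | exact: Qv].
Qed.

End RightAction.

Section GeneratedIdeal.
Variable R : pzRingType.
Implicit Types (s r t : R) (S : set R).

Lemma gen_ideal_mem s : gen_ideal s s.
Proof. by move=> J [_]; apply. Qed.

Lemma two_sided_ideal_gen s : two_sided_ideal (gen_ideal s).
Proof.
split=> [|r x Ix J JP|r x Ix J JP].
- split=> [|x y /set_mem Ix /set_mem Iy]; apply/mem_set => J JP.
    by have [[[J0 _] _ _] _] := JP; apply: set_mem J0.
  have [[[_ JB] _ _] _] := JP.
  by apply/set_mem/JB; apply/mem_set; [exact: Ix | exact: Iy].
- by have [[_ JMl _] _] := JP; apply: JMl (Ix J JP).
- by have [[_ _ JMr] _] := JP; apply: JMr (Ix J JP).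
Qed.

Lemma gen_idealMl s r t : gen_ideal s t -> gen_ideal s (r * t).
Proof. by have [_ + _] := two_sided_ideal_gen s; apply. Qed.

Lemma gen_idealMr s r t : gen_ideal s t -> gen_ideal s (t * r).
Proof. by have [_ _ +] := two_sided_ideal_gen s; apply. Qed.

(** The m-system axiom puts some b r s, an element of b <s>, in S. *)
Lemma no_ideal_multiple_in_res_ring (M : lmodType R^c) (P : set M) S (b s : R) :
  m_system S -> res_ring P `&` S = set0 -> S b -> S s ->
  ~ (forall t, gen_ideal s t -> res_ring P (b * t)).
Proof.
move=> [_ Ssys] PS0 Sb Ss bsP; have [r Sbrs] := Ssys b s Sb Ss.
suff: (res_ring P `&` S) (b * r * s) by rewrite PS0.
split=> //; rewrite -mulrA; apply: bsP.
by apply: gen_idealMl; exact: gen_ideal_mem.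
Qed.

End GeneratedIdeal.

Theorem theorem2p6 (R : pzRingType) (S : set R) (M : lmodType R^c) (P : set M)
    (hS : m_system S) (hP : submodule P) (hPS : res_ring P `&` S = set0) :
  S_prime_submodule S P <->
  exists2 s, S s & prime_submodule (res_mod P (gen_ideal s)).
Proof.
split=> [[_ _ [s Ss Sprime]]|[s Ss [_ Qprime]]]; last first.
  split=> //; exists s => // a m mRaP.
  case: (Qprime a m) => [r t _|aQ|]; [|left|by right].
    exact: submodule_ract.
  by move=> t It n; rewrite -ractM; apply: aQ.
exists s => //; split; first exact/submodule_res_mod/two_sided_ideal_gen.
move=> a m mRaQ; have [Qm|nQm] := pselect (res_mod P (gen_ideal s) m).
  by right.
left.
have aIIP t t' : gen_ideal s t -> gen_ideal s t' -> res_ring P (a * t * t').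
  move=> It It'; case: (Sprime (a * t) m) => [r|atIP|//]; last exact: atIP.
  by rewrite -ractM; apply: mRaQ.
have [r Ssrs] := hS.2 s s Ss Ss.
move=> n; case: (Sprime (s * r * s) (n \ra a)) => [r'|srsIP|//].
  (* n a r' (s r s) is regrouped as n (a (r' s r) s), with r' s r in <s>. *)
  rewrite !ractM !mulrA -[a * r' * s]mulrA -[a * _ * r]mulrA.
  apply: aIIP; last exact: gen_ideal_mem.
  by apply: gen_idealMr; apply: gen_idealMl; exact: gen_ideal_mem.
by case: (no_ideal_multiple_in_res_ring _ _ _ _ _ _ hS hPS Ssrs Ss srsIP).
Qed.
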